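(* Let $h(n)$, $n\ge 1$, be the integers defined by $\sum_{n=1}^{\infty} h(n)q^n=\sum_{n=1}^{\infty}\frac{(-1)^{n+1}q^{n(n+1)/2}}{1-q^n}$. For every positive integer $n$, $h(n)$ is odd if and only if $n$ is a square or a double square. Hence, for almost all positive integers $n$, $h(n)\equiv 0\pmod 2$.
   Context: The identity defining $h(n)$ is an identity of formal power series in $q$, with each $\frac{1}{1-q^n}$ expanded as $\sum_{m\ge 0}q^{nm}$. A square is an integer of the form $x^2$ and a double square is an integer of the form $2x^2$, with $x$ a positive integer. ''For almost all positive integers $n$'' means that the set of exceptional positive integers has natural density zero. *)

(* Defs.v *)
From mathcomp Require Import all_boot all_order all_algebra.
From mathcomp Require Import zify.
From mathcomp Require Import all_classical all_reals all_analysis.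

Set Implicit Arguments.
Unset Strict Implicit.
Unset Printing Implicit Defensive.

Import Order.TTheory GRing.Theory Num.Theory.
Import numFieldNormedType.Exports.

Local Open Scope classical_set_scope.
Local Open Scope ring_scope.

(* f k is the coefficient of q^k. *)
Definition fps := nat -> int.

Definition fps_monomial (n : nat) : fps := fun k => (k == n)%:R.

Definition fps_scale (c : int) (f : fps) : fps := fun k => c * f k.

Definition fps_mul (f g : fps) : fps :=
  fun k => \sum_(i < k.+1) f i * g (k - i)%N.

(* Convergence for the q-adic topology, i.e. every coefficient of the partial
   sums is eventually constant; the summation index starts at m0. *)
Definition fps_has_sum (m0 : nat) (F : nat -> fps) (S : fps) : Prop :=
  forall k, exists N, forall M, (N <= M)%N ->
    \sum_(m0 <= m < M) F m k = S k.

(* The expansion of 1 / (1 - q^n) for n > 0, see fps_geomP. *)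
Definition fps_geom (n : nat) : fps := fun k => (n %| k)%N%:R.

Lemma fps_geomP (n : nat) : (0 < n)%N ->
  fps_has_sum 0 (fun m => fps_monomial (n * m)) (fps_geom n).
Proof.
move=> n0 k; exists k.+1 => M kM; rewrite /fps_geom /fps_monomial.
have [/dvdnP[m km]|nk] := boolP (n %| k)%N.
  have mM : (m < M)%N by nia.
  rewrite big_mkord (bigD1 (Ordinal mM)) //= km mulnC eqxx big1 ?addr0 // => i.
  rewrite -val_eqE /= eqn_pmul2l // => /negPf im.
  by rewrite eq_sym im.
rewrite big1 // => m _; case: eqP => // km.
by rewrite km dvdn_mulr in nk.
Qed.

(* (-1)^(n+1) q^(n(n+1)/2) / (1 - q^n) *)
Definition h_term (n : nat) : fps :=
  fps_scale ((-1) ^+ n.+1)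
    (fps_mul (fps_monomial ((n * n.+1) %/ 2)) (fps_geom n)).

(* The identity between the sums over n >= 1 of h(n) q^n and of h_term n;
   it does not constrain h 0. *)
Definition h_identity (h : nat -> int) : Prop :=
  exists S : fps,
    fps_has_sum 1 (fun n => fps_scale (h n) (fps_monomial n)) S /\
    fps_has_sum 1 h_term S.

Lemma h_term_small (n k : nat) : (k < n)%N -> h_term n k = 0.
Proof.
move=> kn; rewrite /h_term /fps_scale /fps_mul big1 ?mulr0 // => i _.
rewrite /fps_monomial; case: eqP => [ni|_]; last by rewrite mul0r.
have ik := ltn_ord i.
have : (n * 2 <= n * n.+1)%N by nia.
by lia.
Qed.

Lemma fps_has_sum_coef (h : nat -> int) :
  fps_has_sum 1 (fun n => fps_scale (h n) (fps_monomial n))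
    (fun k => if k is 0 then 0 else h k).
Proof.
move=> k; exists k.+1 => M kM; rewrite /fps_scale /fps_monomial.
case: k kM => [|k] kM.
  by rewrite big_nat_cond big1 // => -[|m] //; rewrite mulr0.
rewrite (@big_cat_nat _ _ _ k.+2) //= big_nat_recr //= eqxx mulr1.
rewrite big_nat_cond big1 ?add0r; last first.
  move=> m; rewrite andbT => /andP[_ mk].
  by rewrite (gtn_eqF mk) mulr0.
rewrite big_nat_cond big1 ?addr0 // => m; rewrite andbT => /andP[mk _].
by rewrite (ltn_eqF mk) mulr0.
Qed.

(* The identity determines the integers h(n), n >= 1. *)
Lemma h_identity_exists : exists h, h_identity h.
Proof.
exists (fun k => \sum_(1 <= n < k.+1) h_term n k).
exists (fun k => if k is 0 then 0 else \sum_(1 <= n < k.+1) h_term n k).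
split; first exact: fps_has_sum_coef.
move=> k; exists k.+1 => M kM.
rewrite (@big_cat_nat _ _ _ k.+1) //=.
have -> : \sum_(k.+1 <= n < M) h_term n k = 0.
  rewrite big_nat_cond big1 // => n; rewrite andbT => /andP[kn _].
  exact: h_term_small.
by rewrite addr0; case: k kM => [|k] _ //; rewrite big_geq.
Qed.

Lemma fps_has_sum_unique m0 F S S' :
  fps_has_sum m0 F S -> fps_has_sum m0 F S' -> S =1 S'.
Proof.
move=> FS FS' k; have [N HN] := FS k; have [N' HN'] := FS' k.
by rewrite -(HN (maxn N N')) ?leq_maxl // (HN' (maxn N N')) // leq_maxr.
Qed.

Lemma h_identity_unique (h h' : nat -> int) (n : nat) :
  h_identity h -> h_identity h' -> (0 < n)%N -> h n = h' n.
Proof.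
move=> [S [hS tS]] [S' [hS' tS']]; case: n => // n _.
have e := fps_has_sum_unique (fps_has_sum_coef h) hS n.+1.
have e' := fps_has_sum_unique (fps_has_sum_coef h') hS' n.+1.
by rewrite /= in e e'; rewrite e e'; exact: fps_has_sum_unique tS tS' _.
Qed.

Definition is_square (n : nat) : Prop :=
  exists x : nat, (0 < x)%N /\ n = (x ^ 2)%N.

Definition is_double_square (n : nat) : Prop :=
  exists x : nat, (0 < x)%N /\ n = (2 * x ^ 2)%N.

(* A set of positive integers: membership of 0 in A is irrelevant. *)
Definition has_natural_density (R : realType) (A : pred nat) (d : R) : Prop :=
  ((count A (iota 1 N))%:R / N%:R : R) @[N --> \oo] --> d.

Definition for_almost_all (R : realType) (P : pred nat) : Prop :=
  @has_natural_density R (predC P) 0.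

(* Main.v *)
Require Import Defs.
From mathcomp Require Import all_boot all_order all_algebra.
From mathcomp Require Import all_classical all_reals all_analysis.
From mathcomp Require Import zify.
Import Order.TTheory GRing.Theory Num.Theory.
Import numFieldNormedType.Exports.

(** Modulo 2 the signs disappear, so h(n) has the parity of the number of
m >= 1 such that t(m) <= n and m divides n - t(m), where t(m) = m(m+1)/2
([h_mod2]).  These m are in bijection with the odd divisors d of n.

- If m is odd, m divides t(m), so m is an odd divisor of n, and t(m) <= n
  means m^2 < 2n ([tri_dvd_odd]).
- If m = 2j, then t(m) is congruent to j modulo 2j, so n = jd with d odd, and
  t(m) <= n means 2j < d, that is d^2 > 2n ([tri_dvd_double]).

Since an odd d never satisfies d^2 = 2n, each odd divisor of n is reached
exactly once ([perm_tri_dvd_odd_divisors]).  The odd divisors of n are the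
divisors of its odd part; the number of divisors of an integer is odd exactly
when the integer is a square ([odd_size_divisors]), and the odd part of n is a
square exactly when n is a square or a double square ([odd_part_square]).

For the density, there are at most 2 sqrt(N) squares and double squares up
to N ([count_square_double_square]), which is negligible with respect to N
([natural_density0_count_sq]). *)

Local Open Scope ring_scope.

Definition tri_dvd (n m : nat) : bool :=
  (((m * m.+1) %/ 2 <= n) && (m %| n - (m * m.+1) %/ 2))%N.

Lemma h_termE (m k : nat) : h_term m k = (-1) ^+ m.+1 * (tri_dvd k m)%:R.
Proof.
rewrite /h_term /fps_scale /fps_mul /tri_dvd /fps_monomial /fps_geom.
congr (_ * _); set t := ((m * m.+1) %/ 2)%N.
have [tk|kt] /= := leqP t k; last first.
  rewrite big1 // => i _; case: eqP => [it|_]; last by rewrite mul0r.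
  by have := ltn_ord i; lia.
have tk1 : (t < k.+1)%N by [].
rewrite (bigD1 (Ordinal tk1)) //= eqxx mul1r big1 ?addr0 // => i.
by rewrite -val_eqE /= => /negPf ->; rewrite mul0r.
Qed.

Lemma h_sum_h_term (h : nat -> int) (n : nat) : h_identity h -> (0 < n)%N ->
  h n = \sum_(1 <= m < n.+1) h_term m n.
Proof.
move=> [S [hS tS]] n0.
have := fps_has_sum_unique (fps_has_sum_coef h) hS n.
case: n n0 => // n _ ->; have [N NS] := tS n.+1.
rewrite -(NS (maxn N n.+2)) ?leq_maxl //.
rewrite (@big_cat_nat _ _ _ n.+2) ?leq_maxr //=.
rewrite [X in _ + X]big_nat_cond [X in _ + X]big1 ?addr0 // => m.
by rewrite andbT => /andP[nm _]; exact: h_term_small.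
Qed.

(** The coefficient of q^n in the m-th summand is, up to sign, the indicator
of [tri_dvd n m], and a sign does not change a parity. *)
Lemma h_mod2 (h : nat -> int) (n : nat) : h_identity h -> (0 < n)%N ->
  (2 %| h n)%Z = ~~ odd (count (tri_dvd n) (iota 1 n)).
Proof.
move=> hh n0; set c := count _ _.
suff e : (2 %| h n - c%:Z)%Z.
  by rewrite -[h n](subrK (c : int)) dvdzE -dvdn2 -[(2 %| c)%N]/(2 %| c%:Z)%Z
    -dvdzE rpredDl.
have -> : c%:Z = \sum_(1 <= m < n.+1) (tri_dvd n m)%:R :> int.
  rewrite /c -sum1_count big_mkcond /= /index_iota subn1 /=.
  rewrite (big_morph Posz PoszD (erefl _)).
  by apply: eq_bigr => m _; case: ifP.
rewrite h_sum_h_term // -sumrB; apply: rpred_sum => m _.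
by rewrite h_termE -signr_odd; case: odd; case: tri_dvd.
Qed.

(** For m odd, m(m+1)/2 is a multiple of m, so the subtraction is invisible to
divisibility; writing n = mk, the size condition (m+1)/2 <= k is m < 2k. *)
Lemma tri_dvd_odd (n m : nat) : (0 < n)%N -> odd m ->
  tri_dvd n m = (m %| n)%N && (m * m < 2 * n)%N.
Proof.
move=> n0 om; rewrite /tri_dvd.
have -> : ((m * m.+1) %/ 2 = m * (m.+1 %/ 2))%N.
  by rewrite muln_divA // dvdn2 /= om.
have m2 : m.+1 = (2 * (m.+1 %/ 2))%N by lia.
set j := (m.+1 %/ 2)%N in m2 *.
have [mn|mn] /= := boolP (m %| n)%N; last first.
  apply/negP => /andP[le d]; case/negP: mn.
  by rewrite -(subnK le) dvdn_addl // dvdn_mulr.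
case/dvdnP: mn => k nE.
have m0 : (0 < m)%N by lia.
have le_lt : (m * j <= n)%N = (m * m < 2 * n)%N.
  by rewrite nE mulnA ltn_pmul2r // mulnC leq_pmul2r //; lia.
rewrite -le_lt; apply/andP/idP => [[]//|le].
by split => //; rewrite nE [(k * m)%N]mulnC -mulnBr dvdn_mulr.
Qed.

(** Here the triangular number is j(2j+1).  Divisibility by 2j forces n = jk,
and then says that k - (2j+1) is even, i.e. that k is odd; given this,
2j+1 <= k is the same as 2j < k. *)
Lemma tri_dvd_double (n j : nat) : (0 < n)%N -> (0 < j)%N ->
  tri_dvd n (2 * j) = [&& (j %| n)%N, odd (n %/ j) & (2 * (j * j) < n)%N].
Proof.
move=> n0 j0; rewrite /tri_dvd -mulnA mulKn //.
have [jn|jn] /= := boolP (j %| n)%N; last first.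
  apply/negP => /andP[le d]; case/negP: jn.
  rewrite -(subnK le) dvdn_addl ?dvdn_mulr //.
  by apply: dvdn_trans d; rewrite dvdn_mull.
case/dvdnP: jn => k nE; rewrite nE mulnK // [(k * j)%N]mulnC -mulnBr.
rewrite [X in (X %| _)%N]mulnC dvdn_pmul2l // leq_pmul2l // mulnCA ltn_pmul2l //.
rewrite dvdn2.
have [le|gt] /= := leqP (2 * j).+1 k; last by lia.
by rewrite oddB //= oddM /=; case: odd.
Qed.

(** The index m of the summand that an odd divisor d of n accounts for: small
divisors give the odd m, large ones the even m. *)
Definition odd_divisor_code (n d : nat) : nat :=
  if (d * d < 2 * n)%N then d else (2 * (n %/ d))%N.

(** The even index 2j comes from the divisor d = n/j, whose square exceeds 2n
precisely when 2j < d; the case d = 2j is excluded because d is odd. *)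
Lemma perm_tri_dvd_odd_divisors (n : nat) : (0 < n)%N ->
  perm_eq [seq m <- iota 1 n | tri_dvd n m]
    [seq odd_divisor_code n d | d <- [seq d <- divisors n | odd d]].
Proof.
move=> n0; apply: uniq_perm.
- by rewrite filter_uniq // iota_uniq.
- rewrite map_inj_in_uniq ?filter_uniq ?divisors_uniq // => d e.
  rewrite !mem_filter -!dvdn_divisors // /odd_divisor_code.
  move=> /andP[od /dvdnP[k dk]] /andP[oe /dvdnP[l el]].
  have d0 : (0 < d)%N by lia.
  have e0 : (0 < e)%N by lia.
  rewrite {2}dk {3}el !mulnK //.
  case: ifP => _; case: ifP => _ //; [by lia|by lia|].
  move=> kl; have {}kl : k = l by lia.
  by subst l; nia.
move=> m; rewrite mem_filter mem_iota add1n ltnS.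
apply/idP/mapP => [/and3P[tm m0 mn]|[d]].
  have [om|em] := boolP (odd m).
    move: tm; rewrite tri_dvd_odd // => /andP[mdn lt].
    exists m; last by rewrite /odd_divisor_code lt.
    by rewrite mem_filter om -dvdn_divisors.
  have mj : m = (2 * (m %/ 2))%N by lia.
  set j := (m %/ 2)%N in mj.
  move: tm; rewrite mj tri_dvd_double //; last by lia.
  move=> /and3P[jn on lt]; exists (n %/ j)%N.
    by rewrite mem_filter on -dvdn_divisors // dvdn_div.
  case/dvdnP: jn => k nE.
  have j0 : (0 < j)%N by lia.
  rewrite /odd_divisor_code; rewrite nE mulnK // ifF; last by nia.
  by rewrite mulKn //; nia.
rewrite mem_filter -dvdn_divisors // => /andP[od dn]; rewrite /odd_divisor_code.
case: ifP => [lt|ge] ->.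
  by rewrite tri_dvd_odd // dn lt /= dvdn_leq //; lia.
case/dvdnP: dn => k nE; have d0 : (0 < d)%N by lia.
have k0 : (0 < k)%N by lia.
(* d * d >= 2 * n only gives 2 * k <= d; the oddness of d makes it strict. *)
have dk : (2 * k < d)%N.
  have : (2 * k <= d)%N by nia.
  by rewrite leq_eqVlt => /orP[/eqP kd|//]; lia.
rewrite nE mulnK // tri_dvd_double ?muln_gt0 ?k0 // mulKn // od dvdn_mulr //=.
by nia.
Qed.

(** The involution d |-> n/d exchanges the divisors below and above the square
root of n, so only a divisor equal to that root contributes to the parity. *)
Lemma odd_size_divisors (n : nat) : (0 < n)%N ->
  odd (size (divisors n)) <-> exists x, n = (x ^ 2)%N.
Proof.
move=> n0; set D := divisors n.
pose lt d := (d * d < n)%N; pose gt d := (n < d * d)%N.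
pose eq d := (d * d == n)%N.
have sz : size D = (count lt D + count gt D + count eq D)%N.
  rewrite -(count_predC lt D) -addnA; congr (_ + _)%N.
  rewrite -(count_predUI gt eq) [X in (_ + X)%N](_ : _ = 0)%N ?addn0.
    by apply: eq_count => d; rewrite /= /lt /gt /eq; lia.
  by apply/eqP; rewrite -leqn0 leqNgt -has_count; apply/hasP => -[d _] /=;
    rewrite /gt /eq; lia.
have ltgt : count lt D = count gt D.
  rewrite -!size_filter -[LHS](size_map (fun d => n %/ d)%N).
  apply: perm_size; apply: uniq_perm.
  - rewrite map_inj_in_uniq ?filter_uniq ?divisors_uniq // => d e.
    rewrite !mem_filter -!dvdn_divisors // => /andP[_ dn] /andP[_ en] de.
    by have := divnK dn; have := divnK en; rewrite /= in de *; rewrite de; nia.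
  - by rewrite filter_uniq ?divisors_uniq.
  move=> m; rewrite mem_filter -dvdn_divisors //.
  apply/mapP/andP => [[d]|[gm mn]].
    rewrite mem_filter -dvdn_divisors // => /andP[ld dn] ->; split.
      case/dvdnP: dn ld n0 => k nE; rewrite /lt /gt nE muln_gt0 => + /andP[k0 d0].
      by rewrite mulnK // ltn_pmul2r // ltn_pmul2l.
    exact: dvdn_div.
  exists (n %/ m)%N.
    rewrite mem_filter -dvdn_divisors // dvdn_div // andbT.
    case/dvdnP: mn gm n0 => k nE; rewrite /lt /gt nE muln_gt0 => + /andP[k0 m0].
    by rewrite mulnK // ltn_pmul2r // ltn_pmul2l.
  by case/dvdnP: mn n0 => k ->; rewrite muln_gt0 => /andP[k0 m0];
    rewrite mulnK // mulKn.
rewrite sz ltgt addnn oddD odd_double /=.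
split=> [oc|[x nE]].
  have /hasP[x _ /eqP xx] : has eq D by rewrite has_count; case: count oc.
  by exists x; rewrite -mulnn.
rewrite (@eq_count _ eq (pred1 x)); last by move=> d; rewrite /eq /= nE -mulnn; nia.
by rewrite count_uniq_mem ?divisors_uniq // -dvdn_divisors // nE dvdn_mulr.
Qed.

Lemma size_odd_divisors (n : nat) : (0 < n)%N ->
  size [seq d <- divisors n | odd d] = size (divisors (n`_2^')%N).
Proof.
move=> n0; apply/perm_size/uniq_perm; rewrite ?filter_uniq ?divisors_uniq //.
move=> d; rewrite mem_filter -!dvdn_divisors ?part_gt0 //.
apply/andP/idP => [[od dn]|dn].
  rewrite -(partnC 2%N n0) p_part in dn.
  by rewrite Gauss_dvdr ?coprimeXr ?coprimen2 in dn.
split; last exact: dvdn_trans dn (dvdn_part _ _).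
by rewrite -coprime2n; apply: coprime_dvdr dn _; rewrite coprime2n odd_2'nat part_pnat.
Qed.

(** Write n = 2^e N with N odd.  If N is a square, the parity of e decides
between square and double square.  Conversely, taking odd parts is
multiplicative, so it sends x^2 and 2x^2 to the square of the odd part of x. *)
Lemma odd_part_square (n : nat) : (0 < n)%N ->
  (exists x, (n`_2^')%N = (x ^ 2)%N) <-> is_square n \/ is_double_square n.
Proof.
move=> n0; split=> [[x xE]|].
  have := partnC 2%N n0; rewrite p_part xE -(odd_double_half (logn 2 n)).
  set a := (_./2)%N => nE.
  have x0 : (0 < x)%N by move: n0; rewrite -nE; case: (x); lia.
  have sqE : ((2 ^ a * x) ^ 2 = 2 ^ a.*2 * x ^ 2)%N.
    by rewrite expnMn -expnM muln2.
  have [on|on] := boolP (odd (logn 2 n)); [right|left]; exists (2 ^ a * x)%N;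
    rewrite muln_gt0 expn_gt0 x0 sqE -[LHS]nE ?on ?(negPf on) //.
  by rewrite expnD expn1 mulnA.
case=> -[x [x0 ->]]; exists (x`_2^')%N.
  by rewrite partnX.
rewrite partnM ?expn_gt0 ?x0 // partnX -[RHS]mul1n; congr (_ * _)%N.
by apply: part_p'nat; rewrite pnatNK pnat_id.
Qed.

Lemma odd_count_tri_dvd (n : nat) : (0 < n)%N ->
  odd (count (tri_dvd n) (iota 1 n)) <-> is_square n \/ is_double_square n.
Proof.
move=> n0; rewrite -size_filter (perm_size (perm_tri_dvd_odd_divisors n n0)).
rewrite size_map size_odd_divisors // odd_size_divisors ?part_gt0 //.
exact: odd_part_square.
Qed.

(** Both x^2 <= N and 2x^2 <= N force x <= s, which leaves s candidates of each
kind. *)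
Lemma count_square_double_square (A : pred nat) (N s : nat) :
  (forall n, (0 < n)%N -> A n -> is_square n \/ is_double_square n) ->
  (N < s.+1 ^ 2)%N -> (count A (iota 1 N) <= 2 * s)%N.
Proof.
move=> AP Ns; rewrite -size_filter.
have -> : (2 * s = size ([seq x ^ 2 | x <- iota 1 s]
                         ++ [seq 2 * x ^ 2 | x <- iota 1 s]))%N.
  by rewrite size_cat !size_map size_iota mul2n addnn.
apply: uniq_leq_size; first by rewrite filter_uniq ?iota_uniq.
move=> n; rewrite mem_filter mem_iota mem_cat => /and3P[An n0 nN].
have lex x : (x ^ 2 <= n)%N -> (x <= s)%N by rewrite -!mulnn in Ns *; nia.
case: (AP n n0 An) => -[x [x0 nE]]; apply/orP; [left|right];
  by apply/mapP; exists x => //; rewrite mem_iota x0 add1n ltnS lex // nE; lia.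
Qed.

(** If c is the number of elements up to N, then (c/N)^2 <= C/N tends to 0.
Bounding the square of c avoids any real square root. *)
Lemma natural_density0_count_sq (R : realType) (A : pred nat) (C : nat) :
  (forall N, (count A (iota 1 N)) ^ 2 <= C * N)%N ->
  @has_natural_density R A 0.
Proof.
move=> AC; apply/cvgrPdist_lt => e e0.
near=> N.
rewrite sub0r normrN ger0_norm ?divr_ge0 ?ler0n //.
have N0 : (0 < N%:R :> R) by rewrite ltr0n; near: N; exact: nbhs_infty_gt.
rewrite ltr_pdivrMr // -(@ltr_pXn2r _ 2) ?nnegrE ?ler0n //; last first.
  by rewrite mulr_ge0 // ltW.
rewrite -natrX (@le_lt_trans _ _ (C * N)%:R) ?ler_nat ?AC // natrM exprMn.
rewrite [X in _ < _ * X]expr2 mulrA ltr_pM2r // mulrC -ltr_pdivrMr ?exprn_gt0 //.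
by near: N; exact: nbhs_infty_gtr.
Unshelve. all: by end_near. Qed.

Theorem theorem1p5 (R : realType) (h : nat -> int) (hh : h_identity h) :
  (forall n : nat, (0 < n)%N ->
     (~~ (2 %| h n)%Z <-> is_square n \/ is_double_square n)) /\
  for_almost_all R (fun n => (h n == 0 %[mod 2])%Z).
Proof.
have odd_h n : (0 < n)%N ->
    (~~ (2 %| h n)%Z <-> is_square n \/ is_double_square n).
  by move=> n0; rewrite h_mod2 // negbK; exact: odd_count_tri_dvd.
split=> //; apply: (@natural_density0_count_sq _ _ 4) => N.
(* s is the integer part of the square root of N. *)
have [s sN Ns] : exists2 s, (s ^ 2 <= N)%N & (N < s.+1 ^ 2)%N.
  elim: N => [|N [s sN Ns]]; first by exists 0%N.
  have [le|gt] := leqP (s.+1 ^ 2)%N N.+1; last by exists s => //; lia.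
  by exists s.+1 => //; rewrite -!mulnn in Ns *; nia.
apply: (@leq_trans ((2 * s) ^ 2)); last by rewrite expnMn leq_mul2l sN.
rewrite leq_sqr; apply: count_square_double_square => // n n0 /=.
by rewrite mod0z (sameP eqP dvdz_mod0P) => /odd_h; apply.
Qed.
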